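(* Let $X$ be a set and let $\varnothing\neq Z\subseteq Y\subseteq X$. Then $\mathcal{T}(X,Y,Z)$ is a regular semigroup if and only if one of the following statements holds: (i) $|Y|=1$; (ii) $X=Y$ and $|Z|=1$; (iii) $Z=Y=X$.
   Context: $\mathcal{T}(X)$ is the full transformation semigroup on $X$ (all maps $X\to X$ under composition). Maps are written on the right, so $x(\alpha\beta)=(x\alpha)\beta$, and $A\alpha=\{a\alpha : a\in A\}$ for $A\subseteq X$. For $\varnothing\neq Z\subseteq Y\subseteq X$, $\mathcal{T}(X,Y,Z)=\{\alpha\in\mathcal{T}(X): Y\alpha\subseteq Z\}$, a subsemigroup of $\mathcal{T}(X)$. An element $x$ of a semigroup $S$ is regular in $S$ if $x=xyx$ for some $y\in S$; $S$ is a regular semigroup if every element of $S$ is regular in $S$. *)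

(* Defs.v *)
From HB Require Import structures.
From mathcomp Require Import all_boot.
From mathcomp Require Import boolp classical_sets functions cardinality.

Set Implicit Arguments.
Unset Strict Implicit.
Unset Printing Implicit Defensive.

Local Open Scope classical_set_scope.
Local Open Scope group_scope.

Section Regularity.
Variable S : semigroupType.

Definition regular (x : S) : Prop := exists y : S, x = x * y * x.

Definition regular_semigroup : Prop := forall x : S, regular x.

End Regularity.

Arguments regular_semigroup S : clear implicits.

Definition transf (X : Type) : Type := X -> X.

Section Transf.
Variable X : Type.

HB.instance Definition _ := gen_eqMixin (transf X).
HB.instance Definition _ := gen_choiceMixin (transf X).

(* Maps act on the right: x (alpha * beta) = (x alpha) beta. *)
Definition transf_mul (alpha beta : transf X) : transf X :=
  fun x => beta (alpha x).

Lemma transf_mulA : associative transf_mul.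
Proof. by []. Qed.

HB.instance Definition _ := isSemigroup.Build (transf X) transf_mulA.

Definition transf_into (Y Z : set X) : set (transf X) :=
  [set alpha | alpha @` Y `<=` Z].

(* The inclusion sZY is not used by the fields, but closure under composition
   needs it: having it in the type lets the semigroup structure be inferred. *)
Record transf_sub (Y Z : set X) (sZY : Z `<=` Y) : Type := TransfSub {
  transf_sub_val :> transf X;
  transf_subP : transf_sub_val \in transf_into Y Z
}.

Section TransfSub.
Variables (Y Z : set X) (sZY : Z `<=` Y).

Lemma transf_into_mulg_closed :
  mulg_closed (fun alpha : transf X => alpha \in transf_into Y Z).
Proof.
move=> alpha beta /set_mem sa /set_mem sb; apply/mem_set => _ [x Yx <-].
by apply: sb; exists (alpha x) => //; apply/sZY/sa; exists x.
Qed.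

HB.instance Definition _ := [isSub for @transf_sub_val Y Z sZY].
HB.instance Definition _ := [Choice of transf_sub sZY by <:].
HB.instance Definition _ :=
  SubChoice_isSubSemigroup.Build _ _ (transf_sub sZY) transf_into_mulg_closed.

End TransfSub.
End Transf.

(* Main.v *)
(** An element [alpha] of T(X,Y,Z) is regular iff every point of [Y] in the
    image of [alpha] already has a preimage in [Z], because an inverse of
    [alpha] must send [Y] into [Z].  A two-valued map [w |-> y], [x |-> z]
    (x <> w) with [w] outside [Z] violates this as soon as [y <> z], and it lies
    in T(X,Y,Z) when [w] is outside [Y] or [y] is in [Z]. *)
Require Import Defs.
From mathcomp Require Import all_boot.
From mathcomp Require Import boolp classical_sets functions cardinality.

Local Open Scope classical_set_scope.
Local Open Scope card_scope.

Lemma card_eq_I1P (T : Type) (A : set T) (a : T) :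
  A a -> A #= `I_1 <-> forall x, A x -> x = a.
Proof.
move=> Aa; split=> [A1 x Ax|Aa1].
- have /card_set_bijP[f [fA finj _]] := A1.
  apply: finj; rewrite ?inE //.
  have := fA _ Ax; have := fA _ Aa => /=.
  by case: (f a) => // _; case: (f x).
- have -> : A = [set a] by apply/seteqP; split=> [x /Aa1 //|x ->].
  exact/card_set1.
Qed.

Section Regularity.
Context {X : Type} {Y Z : set X} {sZY : Z `<=` Y}.
Implicit Type alpha : transf_sub sZY.

Lemma transf_subE alpha x : Y x -> Z (val alpha x).
Proof. by move=> Yx; have /set_mem := transf_subP alpha; apply; exists x. Qed.

Lemma transf_sub_regularP alpha : Z !=set0 ->
  regular alpha <-> range (val alpha) `&` Y `<=` val alpha @` Z.
Proof.
move=> [z0 Zz0]; split=> [[beta ab] _ [[x _ <-] Yx]|imY].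
  exists (val beta (val alpha x)); first exact: transf_subE.
  by rewrite [in RHS]ab.
(* The inverse [b] is chosen pointwise: a preimage in [Z] if there is one, else any preimage, else
   the default [z0]. In the second case [imY] keeps [x] out of [Y], so [b] still sends [Y] into
   [Z]. *)
have /choice[b bP] : forall x, exists t,
    (range (val alpha) x -> val alpha t = x) /\ (Y x -> Z t).
  move=> x; have [[z Zz zx]|nZx] := pselect ((val alpha @` Z) x).
    by exists z.
  have [[t _ tx]|nx] := pselect (range (val alpha) x); last by exists z0.
  by exists t; split=> // Yx; case: nZx; apply: imY; split=> //; exists t.
have bYZ : b \in transf_into Y Z.
  by apply/mem_set => _ [x Yx <-]; exact: (bP x).2.
exists (TransfSub sZY bYZ); apply: val_inj; apply/funext => x /=.
by symmetry; apply: (bP (val alpha x)).1; exists x.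
Qed.

Lemma regular_transf_sub_eq w y z :
  regular_semigroup (transf_sub sZY) ->
  Z z -> Y y -> ~ Z w -> ~ Y w \/ Z y -> y = z.
Proof.
move=> reg Zz Yy nZw wy.
pose a : transf X := fun x => if pselect (x = w) then y else z.
have aYZ : a \in transf_into Y Z.
  apply/mem_set => _ [x Yx <-]; rewrite /a.
  by case: pselect => // xw; case: wy => // nYw; case: nYw; rewrite -xw.
have Z0 : Z !=set0 by exists z.
have /(transf_sub_regularP _ Z0) := reg (TransfSub sZY aYZ).
(* The value [y] is taken at [w], so regularity gives it a preimage [t] in [Z]. Since [w] is not in
   [Z], [t] differs from [w] and its value is [z]. *)
case/(_ y) => [|t Zt /=].
  by split=> //; exists w => //=; rewrite /a; case: pselect.
by rewrite /a; case: pselect => // tw; case: nZw; rewrite -tw.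
Qed.

End Regularity.

Theorem theorem2p6 (X : Type) (Y Z : set X) (Z0 : Z !=set0) (sZY : Z `<=` Y) :
  regular_semigroup (transf_sub sZY) <->
  [\/ Y #= `I_1,
      [set: X] = Y /\ Z #= `I_1
    | Z = Y /\ Y = [set: X]].
Proof.
have [z Zz] := Z0; have Yz := sZY _ Zz.
rewrite (propext (card_eq_I1P _ _ _ Yz)) (propext (card_eq_I1P _ _ _ Zz)).
split=> [reg|XYZ alpha].
(* A point outside [Y] forces (i); if [Y] is everything, a point outside [Z] forces (ii); otherwise
   (iii) holds. *)
- have [[w nYw]|/forallNP nY] := pselect (exists w, ~ Y w).
    constructor 1 => y Yy.
    by apply: (regular_transf_sub_eq w _ _ reg) => //; [move/sZY|left].
  have YT : Y = setT.
    by apply/seteqP; split=> // x _; apply: contrapT; exact: nY.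
  have [[w nZw]|/forallNP nZ] := pselect (exists w, ~ Z w).
    constructor 2; split=> // y Zy.
    by apply: (regular_transf_sub_eq w _ _ reg) => //; [exact: (sZY y)|right].
  constructor 3; split=> //; apply/seteqP; split=> // x _.
  by apply: contrapT; exact: nZ.
- apply/(transf_sub_regularP _ Z0) => _ [[x _ <-] Yax].
  (* In (iii) [x] itself lies in [Z]. In (i) and (ii) the preimage is [z], since [val alpha x] and
     [val alpha z] both equal [z]. *)
  case: XYZ => [Y1|[YT Z1]|[ZY YT]]; last by exists x => //; rewrite ZY YT.
  + by exists z => //; rewrite (Y1 _ Yax); apply/Y1/sZY/transf_subE.
  + exists z => //; have Yx : Y x by rewrite -YT.
    by transitivity z; last symmetry; apply: Z1; exact: transf_subE.
Qed.
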